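(* Let $n\ge 1$. Suppose that key $1$ is kept in hand and the keys $2,\dots,n$ are put uniformly and independently into the $n$ boxes $1,\dots,n$; that is, the boxes $f(2),\dots,f(n)$ containing the keys $2,\dots,n$ are independent random variables, each uniformly distributed on $\{1,\dots,n\}$. Then the probability of winning padlock solitaire is $1/n$.
   Context: Padlock solitaire: there are $n$ locked boxes labeled $1,\dots,n$; key $j$ opens box $j$ and only box $j$. The player keeps key $1$, and each key $j\in\{2,\dots,n\}$ is locked in some box $f(j)\in\{1,\dots,n\}$. The player opens box $1$ with key $1$ and takes all keys in it; then, as long as the player holds a key to a box that is still locked, the player opens such a box and takes all keys in it. The player wins if all keys are eventually recovered, equivalently all boxes can be unlocked. Thus the set of boxes that get opened is the smallest set $O\subseteq\{1,\dots,n\}$ with $1\in O$ and such that $f(j)\in O$ implies $j\in O$, and the player wins if and only if $O=\{1,\dots,n\}$. *)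

(* Defs.v *)
From HB Require Import structures.
From mathcomp Require Import all_boot all_order all_algebra.
From mathcomp Require Import all_classical all_reals all_analysis.
Set Implicit Arguments.
Unset Strict Implicit.
Unset Printing Implicit Defensive.
Import Order.TTheory GRing.Theory Num.Theory.
Local Open Scope classical_set_scope.
Local Open Scope ring_scope.

(* The boxes 1, ..., n are the ordinals 0, ..., n.-1. The alias carries the
   proof of 0 < n because measurable types have to be pointed. *)
Definition box (n : nat) (hn : (0 < n)%N) : Type := 'I_n.

HB.instance Definition _ n (hn : (0 < n)%N) := Finite.copy (box hn) 'I_n.

Definition box1 (n : nat) (hn : (0 < n)%N) : box hn := Ordinal hn.

HB.instance Definition _ n (hn : (0 < n)%N) := isPointed.Build (box hn) (box1 hn).

(* Discrete sigma-algebra: every set of boxes is measurable. *)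
HB.instance Definition _ n (hn : (0 < n)%N) :=
  @isMeasurable.Build default_measure_display (box hn)
    discrete_measurable discrete_measurable0
    discrete_measurableC discrete_measurableU.

(* The keys 2, ..., n; the value of a key is the box that it opens. *)
Definition key (n : nat) (hn : (0 < n)%N) : Type :=
  {j : box hn | j != box1 hn}.

HB.instance Definition _ n (hn : (0 < n)%N) :=
  SubFinite.copy (key hn) {j : box hn | j != box1 hn}.

(* The smallest set of boxes that contains box 1 and that contains the box
   opened by key j whenever it contains the box f j holding key j. *)
Inductive opened (n : nat) (hn : (0 < n)%N) (f : key hn -> box hn) :
    box hn -> Prop :=
  | opened_box1 : opened f (box1 hn)
  | opened_key (j : key hn) : opened f (f j) -> opened f (sval j).

Definition wins (n : nat) (hn : (0 < n)%N) (f : key hn -> box hn) : Prop :=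
  opened f = [set: box hn].

Definition mutually_independent (d d' : measure_display) (T : measurableType d)
    (T' : measurableType d') (R : realType) (P : probability T R) (I : finType)
    (X : I -> {RV P >-> T'}) : Prop :=
  forall (J : {set I}) (A : I -> set T'),
    (forall i, i \in J -> measurable (A i)) ->
    P (\bigcap_(i in [set` J]) (X i @^-1` A i)) =
      (\prod_(i in J) P (X i @^-1` A i))%E.

Definition uniformly_distributed (d : measure_display) (T : measurableType d)
    (R : realType) (P : probability T R) (n : nat) (hn : (0 < n)%N)
    (X : {RV P >-> box hn}) : Prop :=
  forall b : box hn, distribution P X [set b] = (n%:R^-1)%:E.

(* Main.v *)
Require Import Defs.
From HB Require Import structures.
From mathcomp Require Import all_boot all_order all_fingroup all_algebra.
From mathcomp Require Import all_classical all_reals all_analysis.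
Import GRing.Theory Num.Theory.
Local Open Scope classical_set_scope.
Local Open Scope ring_scope.

(** Why the probability is 1/n: the indicator of winning is a determinant
    whose rows are independent, so its expectation is the determinant of the
    expected matrix.

    Let key i be locked in box g i, and let A_g be the 0/1 matrix, indexed by
    the keys, with a 1 at (i, k) when key i lies in the box opened by key k
    (rows of keys lying in box 1 vanish). Then det (1 - A_g) is 1 if g wins
    and 0 otherwise ([findet_laplacian_wins], [findet_laplacian_loses]); this
    is the matrix-tree theorem for a graph in which every non-root vertex has
    exactly one outgoing edge, so that the graph itself is the only candidate
    for a spanning tree.

    Row i of 1 - A_g depends on g i only, and a determinant is multilinear in
    its rows; averaging over independent g i therefore averages each entry
    ([findet_sum]). This gives, for arbitrary laws q i of the boxes, the
    weighted formula [sum_wins]: the probability of winning is the determinant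
    of 1 - Q with Q i k the probability that key i lies in box k.

    For uniform laws Q is the (n - 1) x (n - 1) matrix with all entries 1/n. It
    has rank at most one, so det (1 - Q) = 1 - tr Q = 1 - (n - 1)/n = 1/n
    ([findet_rank1]). *)

(** * Determinants *)

(** Both sides are the determinant of the block matrix
    [1, A; B, 1], factored in its two block-triangular ways. *)
Lemma det_1_sub_mulmx (F : comNzRingType) (m p : nat)
    (A : 'M[F]_(m, p)) (B : 'M[F]_(p, m)) :
  \det (1%:M - A *m B) = \det (1%:M - B *m A).
Proof.
have e1 : block_mx (1%:M - A *m B) A 0 1%:M *m block_mx 1%:M 0 B 1%:M
    = block_mx 1%:M A B 1%:M.
  by rewrite mulmx_block !mulmx1 !mulmx0 !mul1mx !add0r subrK.
have e2 : block_mx 1%:M 0 B 1%:M *m block_mx 1%:M A 0 (1%:M - B *m A)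
    = block_mx 1%:M A B 1%:M.
  by rewrite mulmx_block !mulmx1 !mulmx0 !mul0mx !mul1mx !addr0 addrC subrK.
have := congr1 determinant (etrans e1 (esym e2)).
by rewrite !det_mulmx !det_ublock !det_lblock !det1 !mulr1 !mul1r.
Qed.

Lemma big_enum_valT (S : Type) (idx : S) (op : Monoid.com_law idx)
    (I : finType) (H : I -> S) :
  \big[op/idx]_i H i = \big[op/idx]_(i < #|I|) H (enum_val i).
Proof. by rewrite (reindex _ (onW_bij _ (@enum_val_bij I))). Qed.

(** The determinant of a matrix indexed by an arbitrary finite type; using the
    same enumeration for rows and columns makes it independent of that
    enumeration. *)
Definition findet (F : comNzRingType) (I : finType) (M : I -> I -> F) : F :=
  \det (\matrix_(i < #|I|, k < #|I|) M (enum_val i) (enum_val k)).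

(** Each Leibniz term takes exactly one factor from each row, so once the sums
    are exchanged it splits as a product over rows of independent sums. *)
Lemma findet_sum (F : comNzRingType) (I J : finType)
    (q : I -> J -> F) (B : I -> J -> I -> F) :
  \sum_(g : {ffun I -> J})
     (\prod_i q i (g i)) * findet _ _ (fun i k => B i (g i) k)
  = findet _ _ (fun i k => \sum_b q i b * B i b k).
Proof.
rewrite /findet /determinant.
under eq_bigr do rewrite mulr_sumr.
rewrite exchange_big /=; apply: eq_bigr => s _.
have reE (H : I -> F) : \prod_(i < #|I|) H (enum_val i) = \prod_i H i.
  by rewrite [RHS]big_enum_valT.
transitivity ((-1) ^+ s * \prod_i \sum_b q i b * B i b
    (enum_val (s (enum_rank i)))); last first.
  congr (_ * _); rewrite -reE; apply: eq_bigr => i _.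
  by rewrite mxE enum_valK.
rewrite bigA_distr_bigA mulr_sumr; apply: eq_bigr => g _.
rewrite big_split /= mulrCA; congr (_ * (_ * _)).
by rewrite -reE; apply: eq_bigr => i _; rewrite mxE enum_valK.
Qed.

(** The subtracted matrix is a column of ones times the row v, so
    [det_1_sub_mulmx] reduces the determinant to size one. *)
Lemma findet_rank1 (F : comNzRingType) (I : finType) (v : I -> F) :
  findet _ _ (fun i k => (i == k)%:R - v k) = 1 - \sum_k v k.
Proof.
rewrite /findet.
pose A : 'cV[F]_#|I| := const_mx 1.
pose B : 'rV[F]_#|I| := \row_k v (enum_val k).
transitivity (\det (1%:M - A *m B)).
  congr determinant; apply/matrixP => i k; rewrite !mxE big_ord1 !mxE mul1r.
  by rewrite (inj_eq enum_val_inj).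
rewrite det_1_sub_mulmx det_mx11 !mxE eqxx [in RHS]big_enum_valT; congr (_ - _).
by apply: eq_bigr => k _; rewrite !mxE mulr1.
Qed.

(** * Winning as a determinant *)

Section Padlocks.
Variables (n : nat) (hn : (0 < n)%N).
Implicit Types (g : key hn -> box hn).

Lemma opened_keyE g (j : key hn) : opened g (sval j) <-> opened g (g j).
Proof.
split=> [|gj]; last exact: opened_key.
move E: (sval j) => b ob; case: ob E => [Ej|k gk /val_inj -> //].
by have := svalP j; rewrite Ej eqxx.
Qed.

Lemma card_key : #|{: key hn}| = n.-1.
Proof.
rewrite card_sig (eq_card (B := predC1 (box1 hn))) // cardC1.
by rewrite card_ord.
Qed.

(** The Laplacian of the graph with an edge from each key i to the key of the
    box g i, with the row and the column of box 1 deleted. *)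
Definition laplacian (F : comNzRingType) g (i k : key hn) : F :=
  (i == k)%:R - (g i == sval k)%:R.

Lemma wins_no_loop g (j : key hn) : wins g -> g j != sval j.
Proof.
move=> gwin; have : opened g (sval j) by rewrite gwin.
suff H b : opened g b -> forall k : key hn, sval k = b -> g k != b.
  by move=> /H; apply.
elim=> [k k1|i _ IH k /val_inj ->{k}].
  by have := svalP k; rewrite k1 eqxx.
by apply/eqP => gi; have := IH i (esym gi); rewrite eqxx.
Qed.

(** A permutation of the keys that moves keys only along edges of g must, if it
    moves something, follow a cycle of g, and a winning g has none. By induction
    on the opening order: if key j is moved then it is sent to the key of box
    g j, which is already known to be fixed, against injectivity. *)
Lemma injective_along_wins g (h : key hn -> key hn) :
  wins g -> injective h -> (forall i, h i = i \/ g i = sval (h i)) ->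
  forall i, h i = i.
Proof.
move=> gwin h_inj hg i; have : opened g (sval i) by rewrite gwin.
suff H b : opened g b -> forall k : key hn, sval k = b -> h k = k.
  by move=> /H; apply.
elim=> [k k1|j _ IH k /val_inj ->{k}].
  by have := svalP k; rewrite k1 eqxx.
by case: (hg j) => // /esym gj; apply: h_inj; exact: IH.
Qed.

(** A nonzero Leibniz term comes from a permutation s for which each s i is
    either i or the key of box g i; only the identity is such. *)
Lemma findet_laplacian_wins (F : comNzRingType) g :
  wins g -> findet _ _ (laplacian F g) = 1.
Proof.
move=> gwin; rewrite /findet /determinant (bigD1 1%g) //=.
rewrite [X in _ + X]big1 => [|s s1].
  rewrite odd_perm1 mul1r addr0 big1 // => i _; rewrite mxE perm1.
  by rewrite /laplacian eqxx (negbTE (wins_no_loop _ _ gwin)) subr0.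
apply/eqP; apply: contraNT s1 => term_neq0.
(* h is s read as a permutation of the keys rather than of their ranks. *)
pose h i := enum_val (s (enum_rank i)).
have h_inj : injective h.
  by move=> i j /enum_val_inj/perm_inj/enum_rank_inj.
have hg i : h i = i \/ g i = sval (h i).
  case: (eqVneq (h i) i) => [|hi]; first by left.
  right; apply/eqP; apply: contraNT term_neq0 => gi.
  rewrite (bigD1 (enum_rank i)) //= mxE enum_rankK -/(h i) /laplacian.
  by rewrite [i == _]eq_sym (negbTE hi) (negbTE gi) subrr mul0r mulr0.
have hK := injective_along_wins _ _ gwin h_inj hg.
apply/eqP/permP => i; rewrite perm1; apply: enum_val_inj.
by rewrite -[RHS]hK /h enum_valK.
Qed.

(** The indicator of the boxes that stay locked is a nonzero kernel vector: it
    takes the same value at the box of key i and at g i ([opened_keyE]), and it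
    vanishes at box 1, so deleting that column loses nothing. *)
Lemma findet_laplacian_loses (F : idomainType) g :
  ~ wins g -> findet _ _ (laplacian F g) = 0.
Proof.
move=> glose; apply/eqP; rewrite /findet -det_tr; apply/det0P.
pose u b : F := (~~ `[< opened g b >])%:R.
exists (\row_i u (sval (enum_val i))).
  apply/negP => /eqP v0; apply: glose; apply/seteqP; split=> // b _.
  have [-> | b1] := eqVneq b (box1 hn); first exact: opened_box1.
  have /rowP/(_ (enum_rank (exist _ b b1 : key hn))) := v0.
  rewrite !mxE enum_rankK /u /=; case: asboolP => // _ /eqP.
  by rewrite oner_eq0.
apply/rowP => i; rewrite !mxE.
under eq_bigr do rewrite !mxE.
rewrite (_ : \sum_j _ = \sum_k u (sval k) * laplacian F g (enum_val i) k);
  last by rewrite [RHS]big_enum_valT.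
move: (enum_val i : key hn) => {}i.
under eq_bigr do rewrite /laplacian mulrBr.
rewrite sumrB [X in X - _](bigD1 i) //= eqxx mulr1 big1 => [|k ki]; last first.
  by rewrite eq_sym (negbTE ki) mulr0.
rewrite addr0.
have -> : u (sval i) = u (g i).
  by rewrite /u; congr (~~ _)%:R; apply/asbool_equiv_eq/opened_keyE.
have [gi | gi1] := eqVneq (g i) (box1 hn).
  rewrite big1 => [|k _].
    by rewrite gi /u asboolT ?subrr //; exact: opened_box1.
  by rewrite gi eq_sym (negbTE (svalP k)) mulr0.
pose k0 : key hn := exist _ (g i) gi1.
rewrite (bigD1 k0) //= eqxx mulr1 big1 ?addr0 ?subrr // => k kk0.
rewrite (_ : (g i == sval k) = false) ?mulr0 //.
by apply: contraNF kk0 => /eqP gk; apply/eqP/val_inj.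
Qed.

(** Since each q i has total mass 1, the entry (i == k) is its own average, and
    the averaged Laplacian is the identity minus the matrix of the laws q. *)
Theorem sum_wins (F : idomainType) (q : key hn -> box hn -> F) :
  (forall i, \sum_b q i b = 1) ->
  \sum_(g : {ffun key hn -> box hn} | `[< wins g >]) \prod_i q i (g i)
  = findet _ _ (fun i k => (i == k)%:R - q i (sval k)).
Proof.
move=> q1; transitivity (findet _ _
    (fun i k => \sum_b q i b * ((i == k)%:R - (b == sval k)%:R))); last first.
  congr determinant; apply/matrixP => i k; rewrite !mxE.
  under eq_bigr do rewrite mulrBr.
  rewrite sumrB -mulr_suml q1 mul1r; congr (_ - _).
  rewrite (bigD1 (sval (enum_val k))) //= eqxx mulr1 big1 ?addr0 // => b.
  by move=> /negbTE ->; rewrite mulr0.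
rewrite -findet_sum big_mkcond; apply: eq_bigr => g _.
rewrite -/(laplacian F g).
case: asboolP => [/(findet_laplacian_wins F)|/(findet_laplacian_loses F)] ->.
  by rewrite mulr1.
by rewrite mulr0.
Qed.

End Padlocks.

(** * From random variables to weighted counting *)

(** A discrete event is the finite disjoint union, over the arrangements g that
    realize it, of the events that the random arrangement equals g; independence
    turns each of these into a product. *)
Lemma probability_of_independent_boxes (n : nat) (hn : (0 < n)%N)
    (d : measure_display) (T : measurableType d) (R : realType)
    (P : probability T R) (f : key hn -> {RV P >-> box hn})
    (Q : (key hn -> box hn) -> Prop) :
  mutually_independent f ->
  P [set w | Q (fun j => f j w)] =
  (\sum_(g : {ffun key hn -> box hn} | `[< Q g >])
     \prod_j distribution P (f j) [set g j])%E.
Proof.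
move=> f_indep.
pose E (g : {ffun key hn -> box hn}) :=
  \bigcap_(j in [set` [set: key hn]%SET]) (f j @^-1` [set g j]).
have mE g : measurable (E g).
  apply: fin_bigcap_measurable => [|j _]; first exact: finite_finpred.
  by rewrite -[X in measurable X]setTI; exact: measurable_funP.
have EP g w : E g w <-> g = [ffun j => f j w].
  split=> [Egw|-> j _ /=]; last by rewrite ffunE.
  apply/ffunP => j; rewrite ffunE; symmetry; apply: Egw.
  by rewrite /= inE.
pose D : set {ffun key hn -> box hn} := [set g | Q g].
have -> : [set w | Q (fun j => f j w)] = \bigcup_(g in D) E g.
  have fw w : (fun j => f j w) = [ffun j => f j w] :> (key hn -> box hn).
    by apply/funext => j; rewrite ffunE.
  apply/seteqP; split=> [w /= Qw|w [g Dg /EP gE]].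
    by exists [ffun j => f j w]; [rewrite /D /= -fw|exact/EP].
  by rewrite /= fw -gE.
rewrite measure_fin_bigcup //; first last.
- by move=> g h _ _ [w [/EP -> /EP ->]].
- exact: finite_finset.
have -> : D = [set` (fun g : {ffun key hn -> box hn} => `[< Q g >])].
  by apply/seteqP; split=> g /asboolP.
rewrite -(bigfs _ (index_enum_uniq _)) => [|g _]; last first.
  by rewrite mem_index_enum.
apply: eq_bigr => g _.
apply: (etrans (f_indep [set: key hn]%SET (fun j => [set g j]) _)) => //.
by apply: eq_bigl => j; rewrite inE.
Qed.

Theorem theorem3 (n : nat) (hn : (0 < n)%N) (R : realType)
    (d : measure_display) (T : measurableType d) (P : probability T R)
    (f : key hn -> {RV P >-> box hn})
    (f_indep : mutually_independent f)
    (f_unif : forall j : key hn, uniformly_distributed (f j)) :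
  P [set w : T | wins (fun j : key hn => f j w)] = (n%:R^-1)%:E.
Proof.
rewrite (probability_of_independent_boxes _ _ _ _ _ _ _ _ f_indep).
have n0 : n%:R != 0 :> R by rewrite pnatr_eq0 -lt0n.
under eq_bigr => g _ do (under eq_bigr do rewrite f_unif; rewrite prodEFin).
rewrite sumEFin (sum_wins _ _ _ (fun _ _ => n%:R^-1)) => [|_]; last first.
  by rewrite sumr_const card_ord -[LHS]mulr_natr mulVf.
rewrite findet_rank1 sumr_const card_key; congr _%:E.
have e1 : n%:R^-1 *+ n = 1 :> R by rewrite -[LHS]mulr_natr mulVf.
by rewrite -[X in X - _]e1 -[X in _ *+ X - _](prednK hn) mulrS addrK.
Qed.
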